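(* Let $H=(V,E)$ be a hypergraph such that the degree of each vertex and the cardinality of each edge are even. If $e$ is a cut edge of $H$, then every connected component of $H-e$ contains an even number of vertices of $e$. In particular, $H$ has no strong cut edges.
   Context: A hypergraph $H=(V,E)$ consists of a nonempty finite vertex set $V$, a finite edge set $E$, and an incidence function $\psi:E\to 2^V$; edges are identified with their vertex sets (parallel edges allowed). The degree of a vertex is the number of edges containing it. Two distinct vertices are adjacent via $e$ if both lie in $e$; a walk is a sequence $v_0e_1v_1\dots e_kv_k$ with $v_{i-1},v_i$ adjacent via $e_i$. For an equivalence class $V'$ of ''joined by a walk'', the connected component is $(V',\{f\in E:\emptyset\ne f\subseteq V'\})$; $\omega(H)$ is the number of components. $H-e=(V,E\setminus\{e\})$. An edge $e$ is a cut edge if $\omega(H-e)>\omega(H)$, and a strong cut edge if moreover $\omega(H-e)=\omega(H)+|e|-1$. *)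

(* Defs.v *)
From mathcomp Require Import all_boot.

Set Implicit Arguments.
Unset Strict Implicit.
Unset Printing Implicit Defensive.

(* Edges are indexed by a type of their own, so parallel edges are distinct
   indices with the same [ends]; empty edges are allowed. *)
Record hypergraph := Hypergraph {
  vertex : finType;
  edge : finType;
  ends : edge -> {set vertex};
  vertex_gt0 : 0 < #|vertex|
}.

Definition degree (H : hypergraph) (v : vertex H) : nat :=
  #|[set e : edge H | v \in ends e]|.

Definition adjacent_via (H : hypergraph) (e : edge H) : rel (vertex H) :=
  fun u v => [&& u != v, u \in ends e & v \in ends e].

(* [walk u [:: (e1, v1); ...; (ek, vk)] v]: the sequence u e1 v1 ... ek vk is a
   walk and ends at v; k = 0 is allowed. *)
Fixpoint walk (H : hypergraph) (u : vertex H) (s : seq (edge H * vertex H))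
    (v : vertex H) : bool :=
  if s is (e, w) :: s' then adjacent_via e u w && walk w s' v else u == v.

Definition joined (H : hypergraph) (u v : vertex H) : Prop :=
  exists s, walk u s v.

Definition adjacent (H : hypergraph) : rel (vertex H) :=
  fun u v => [exists e : edge H, adjacent_via e u v].

Lemma joinedP (H : hypergraph) (u v : vertex H) :
  reflect (joined u v) (connect (@adjacent H) u v).
Proof.
apply: (iffP connectP) => [[p + ->]|[s]].
  elim: p u => [|w p IHp] u /=; first by exists [::] => /=.
  case/andP=> /existsP[e uw] /IHp[s ws].
  by exists ((e, w) :: s); rewrite /= uw.
elim: s u => [|[e w] s IHs] u /=; first by move/eqP->; exists [::].
case/andP=> uw /IHs[p wp ->].
by exists (w :: p); rewrite //= wp andbT; apply/existsP; exists e.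
Qed.

Lemma joined_dec (H : hypergraph) (u v : vertex H) : decidable (joined u v).
Proof. exact: decP (joinedP u v). Qed.

(* A component is the pair of its vertex set and its edge set. *)
Definition component_of (H : hypergraph) (C : {set vertex H}) :
    {set vertex H} * {set edge H} :=
  (C, [set f : edge H | (ends f != set0) && (ends f \subset C)]).

Definition components (H : hypergraph) :
    {set {set vertex H} * {set edge H}} :=
  [set component_of C | C in
     equivalence_partition (fun u v : vertex H => joined_dec u v : bool)
       [set: vertex H]].

Definition omega (H : hypergraph) : nat := #|components H|.

Definition delete_edge (H : hypergraph) (e : edge H) : hypergraph :=
  @Hypergraph (vertex H) {f : edge H | f != e} (fun f => ends (val f))
    (vertex_gt0 H).

Definition cut_edge (H : hypergraph) (e : edge H) : bool :=
  omega H < omega (delete_edge e).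

(* The subtraction never truncates, since omega H > 0. *)
Definition strong_cut_edge (H : hypergraph) (e : edge H) : bool :=
  cut_edge e && (omega (delete_edge e) == omega H + #|ends e| - 1).

(* Main.v *)
(* Let C be the vertex set of a component of H - e. An edge f other than e is
   contained in C or disjoint from C, so counting incidences in C shows that
   |C :&: e| is congruent mod 2 to the sum of the degrees over C; hence it is
   even. So at most |e|/2 components of H - e meet e; the others are components
   of H, and H has a further component, the one containing e. Therefore
   omega (H - e) < omega H + |e|/2, which is too small for a strong cut edge. *)
Require Import Defs.
From mathcomp Require Import all_boot.

Set Implicit Arguments.
Unset Strict Implicit.
Unset Printing Implicit Defensive.

Definition cc (H : hypergraph) (u : vertex H) : {set vertex H} :=
  [set v | connect (@adjacent H) u v].

(** Only the vertex sets of the components: [component_of] is injective, so counting these gives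
    [omega]. *)
Definition ccs (H : hypergraph) : {set {set vertex H}} :=
  [set cc u | u : vertex H].

Lemma adjacent_sym (H : hypergraph) : symmetric (@adjacent H).
Proof.
move=> u v; apply/existsP/existsP => -[f /and3P[uv uf vf]];
  by exists f; rewrite /adjacent_via eq_sym uv uf vf.
Qed.

Lemma connect_adjacent_sym (H : hypergraph) : connect_sym (@adjacent H).
Proof. exact/sym_connect_sym/adjacent_sym. Qed.

Lemma cc_eq (H : hypergraph) (u v : vertex H) : v \in cc u -> cc v = cc u.
Proof.
rewrite inE => uv; apply/setP=> w; rewrite !inE.
by rewrite (same_connect (@connect_adjacent_sym H) uv).
Qed.

Lemma cc_refl (H : hypergraph) (u : vertex H) : u \in cc u.
Proof. by rewrite inE. Qed.

Lemma connect_ends (H : hypergraph) (f : edge H) (u v : vertex H) :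
  u \in ends f -> v \in ends f -> connect (@adjacent H) u v.
Proof.
move=> uf vf; have [->//|uv] := eqVneq u v.
by apply/connect1/existsP; exists f; apply/and3P.
Qed.

Lemma ends_sub_cc (H : hypergraph) (f : edge H) (u v : vertex H) :
  v \in ends f -> v \in cc u -> ends f \subset cc u.
Proof.
move=> vf; rewrite inE => uv; apply/subsetP => w wf; rewrite inE.
exact: connect_trans uv (connect_ends vf wf).
Qed.

Lemma componentsE (H : hypergraph) :
  components H = [set component_of C | C in ccs H].
Proof.
have ccE u : [set v in [set: vertex H] | joined_dec u v] = cc u.
  by apply/setP=> v; rewrite !inE; apply: sameP (sumboolP _) (joinedP u v).
rewrite /components; congr [set component_of C | C in pred_of_set _].
apply/setP=> C; apply/imsetP/imsetP => -[u _ ->]; exists u => //.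
Qed.

Lemma omegaE (H : hypergraph) : omega H = #|ccs H|.
Proof. by rewrite /omega componentsE card_imset // => C D []. Qed.

(** Double counting of the incident pairs [(v, f)] with [v] in [C]. *)
Lemma sum_degree (H : hypergraph) (C : {set vertex H}) :
  \sum_(v in C) degree v = \sum_(f : edge H) #|C :&: ends f|.
Proof.
transitivity (\sum_(v in C) \sum_(f : edge H | v \in ends f) 1).
  apply: eq_bigr => v _; rewrite /degree -sum1_card.
  by apply: eq_bigl => f; rewrite inE.
rewrite (exchange_big_dep predT) //=; apply: eq_bigr => f _.
by rewrite -sum1_card; apply: eq_bigl => v; rewrite inE.
Qed.

Lemma sum_even (I : finType) (P : pred I) (F : I -> nat) :
  (forall i, P i -> ~~ odd (F i)) -> ~~ odd (\sum_(i | P i) F i).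
Proof.
by move=> evF; rewrite -dvdn2; apply: dvdn_sum => i /evF; rewrite dvdn2.
Qed.

Lemma card_cc_ends_even (H : hypergraph) (e : edge H)
    (degree_even : forall v : vertex H, ~~ odd (degree v))
    (card_even : forall f : edge H, ~~ odd #|ends f|)
    (u : vertex (delete_edge e)) :
  ~~ odd #|cc u :&: ends e|.
Proof.
set C : {set vertex H} := cc u.
have := sum_even (fun v (_ : v \in C) => degree_even v).
rewrite sum_degree (bigD1 e) //= oddD.
(* An edge [f] other than [e] survives in [H - e]; if it meets [C] it lies inside [C], so its term
   is 0 or the even number [#|ends f|]. *)
have /negPf-> : ~~ odd (\sum_(f | f != e) #|C :&: ends f|).
  apply: sum_even => f fe; have [->|[v]] := set_0Vmem (C :&: ends f).
    by rewrite cards0.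
  rewrite inE => /andP[vC vf].
  have /setIidPr-> : ends f \subset C; last exact: card_even.
  exact: (@ends_sub_cc (delete_edge e) (Sub f fe) u v vf vC).
by rewrite addbF.
Qed.

Lemma cc_delete_edge (H : hypergraph) (e : edge H)
    (u : vertex (delete_edge e)) :
  cc u :&: ends e = set0 -> cc u = cc (u : vertex H) :> {set vertex H}.
Proof.
move=> Ce0; apply/setP=> v; apply/idP/idP; rewrite inE.
  rewrite inE; apply: connect_sub => x y /existsP[f /and3P[_ xf yf]].
  exact: (@connect_ends H (val f)).
(* The class of [u] in [H - e] is closed under adjacency in [H]: [e] has no vertex there, and every
   other edge is still present. *)
move=> uv; rewrite -(@closed_connect _ (@adjacent H) (mem (cc u)) _ u v uv) //.
  exact: (@cc_refl (delete_edge e) u).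
apply: (intro_closed (@connect_adjacent_sym H)) => x y.
case/existsP=> f /and3P[_ xf yf] xC.
have [fe|fe] := eqVneq f e.
  have xe : x \in ends e by rewrite -fe.
  by have: x \in cc u :&: ends e; [apply/setIP | rewrite Ce0 inE].
have := @ends_sub_cc (delete_edge e) (Sub f fe) u x xf xC.
by move/subsetP; apply.
Qed.

(** The classes partition the vertices, so each element of [A] is counted once. *)
Lemma sum_card_ccs (H : hypergraph) (A : {set vertex H}) :
  \sum_(C in ccs H) #|C :&: A| = #|A|.
Proof.
rewrite -sum1_card (partition_big (@cc H) (mem (ccs H))) /=; last first.
  by move=> u _; apply: imset_f.
apply: eq_bigr => _ /imsetP[u _ ->]; rewrite -sum1_card.
apply: eq_bigl => v; rewrite inE andbC; congr (_ && _).
by apply/idP/eqP => [/cc_eq//|<-]; apply: cc_refl.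
Qed.

Lemma omega_delete_edge (H : hypergraph) (e : edge H)
    (degree_even : forall v : vertex H, ~~ odd (degree v))
    (card_even : forall f : edge H, ~~ odd #|ends f|) :
  ends e != set0 -> omega (delete_edge e) < omega H + #|ends e|./2.
Proof.
case/set0Pn=> x xe; rewrite !omegaE.
pose M := [set C : {set vertex H} | C :&: ends e != set0].
(* Classes of [H - e] that miss [e] are classes of [H] other than [cc x], which contains [x] from
   [e]; this makes the bound strict. *)
rewrite -(cardsID M (ccs (delete_edge e))) addnC -addSn; apply: leq_add.
  rewrite (cardsD1 (cc x) (ccs H)) imset_f // ltnS; apply: subset_leq_card.
  apply/subsetP=> C /setDP[/imsetP[u _ ->]]; rewrite inE negbK => /eqP ue0.
  have ue := cc_delete_edge ue0; rewrite !inE; apply/andP; split.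
    apply/eqP=> ux; have := in_set0 x.
    by rewrite -ue0 ux !inE xe connect0.
  by apply/imsetP; exists u.
(* Each class in [M] holds a nonzero even number of vertices of [e], hence at least 2. *)
rewrite -leq_double even_halfK // -(@sum_card_ccs (delete_edge e) (ends e)).
rewrite -muln2 -sum_nat_const [leqRHS](big_setID M) /=.
apply: leq_trans (leq_addr _ _); apply: leq_sum => C /setIP[/imsetP[u _ ->]].
rewrite inE -card_gt0; have := card_cc_ends_even degree_even card_even u.
by case: #|_| => [|[]].
Qed.

Theorem theorem3p22 (H : hypergraph)
    (degree_even : forall v : vertex H, ~~ odd (degree v))
    (card_even : forall f : edge H, ~~ odd #|ends f|) :
  (forall e : edge H, cut_edge e ->
     forall C : {set vertex (delete_edge e)} * {set edge (delete_edge e)},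
       C \in components (delete_edge e) ->
       ~~ odd #|C.1 :&: ends e|) /\
  (forall e : edge H, ~~ strong_cut_edge e).
Proof.
split=> e.
  move=> _ C; rewrite componentsE => /imsetP[_ /imsetP[u _ ->] ->] /=.
  exact: card_cc_ends_even.
apply/andP=> -[]; rewrite /cut_edge => cut_e /eqP strong_e.
(* For empty [e] the strong equation reads [omega H - 1], which cannot exceed [omega H]. *)
have [e0|e_neq0] := eqVneq (ends e) set0.
  by move: cut_e; rewrite strong_e e0 cards0 addn0 ltnNge leq_subr.
have := omega_delete_edge degree_even card_even e_neq0.
rewrite strong_e; have: 0 < #|ends e| by rewrite card_gt0.
(* With [#|ends e|] equal to [2h] and [h > 0], the bound would force [2h - 1 < h]. *)
have := even_halfK (card_even e); set h := _./2 => <-.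
case: h => // h _; rewrite -addnBA // ltn_add2l doubleS subn1 /=.
by rewrite !ltnS -addnn ltnNge leq_addr.
Qed.
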